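(* Let $k\ge2$ and let $a \colon \mathbb{N}_0 \to \mathbb{R}$ be a totally balanced $k$-automatic sequence. Then there exists a constant $c>0$ such that $$\sup_{\alpha\in\mathbb{R}} \left| \mathbb{E}_{n<N}\, a(n)\, e(n\alpha) \right| \ll N^{-c}$$ as $N\to\infty$ (with $c$ and the implicit constant depending on $a$ but not on $N$).
   Context: $\mathbb{N}=\{1,2,\dots\}$, $\mathbb{N}_0=\mathbb{N}\cup\{0\}$, $\mathbb{E}_{n<N}\,x(n)=\frac1N\sum_{n=0}^{N-1}x(n)$, $e(\theta)=e^{2\pi i\theta}$. $X\ll Y$ means $|X|\le CY$ for some constant $C$. For an integer $k\ge 2$ let $\Sigma_k=\{0,\dots,k-1\}$ and let $\Sigma_k^*$ be the set of finite words over $\Sigma_k$ (including the empty word). For $n\in\mathbb{N}_0$, $(n)_k\in\Sigma_k^*$ is the base-$k$ expansion of $n$ without leading zeros, most significant digit on the left ($(0)_k$ is the empty word). A $k$-automaton $(S,s_0,\delta,\tau)$ consists of a finite set of states $S$, an initial state $s_0\in S$, a transition function $\delta\colon S\times\Sigma_k\to S$ and an output function $\tau\colon S\to\Delta$. Extend $\delta$ to $S\times\Sigma_k^*$ by $\delta(s,\text{empty word})=s$ and $\delta(s,uv)=\delta(\delta(s,v),u)$ (so the rightmost digit is read first). A sequence $a\colon\mathbb{N}_0\to\Delta$ is $k$-automatic if $a(n)=\tau(\delta(s_0,(n)_k))$ for some $k$-automaton. A bounded sequence $a\colon\mathbb{N}_0\to\mathbb{C}$ is totally balanced if $\mathbb{E}_{n<N}\,a(qn+r)\to0$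 as $N\to\infty$ for every $q\in\mathbb{N}$, $r\in\mathbb{N}_0$ (equivalently, $\mathbb{E}_{n<N}\,a(n)b(n)\to 0$ for every periodic $b$). *)

(* Defs.v *)
From HB Require Import structures.
From mathcomp Require Import all_boot all_order all_algebra.
From mathcomp Require Import all_classical all_reals all_analysis.
From mathcomp Require Import complex.

Set Implicit Arguments.
Unset Strict Implicit.
Unset Printing Implicit Defensive.

Import Order.TTheory GRing.Theory Num.Theory.
Import numFieldNormedType.Exports.

Local Open Scope classical_set_scope.
Local Open Scope ring_scope.

Section Words.
Variables (k : nat) (hk : (1 < k)%N).

Definition last_digit (n : nat) : 'I_k := Ordinal (ltn_pmod n (ltnW hk)).

(* Words are lists with the leftmost (most significant) digit at the head.
   The recursion is on an upper bound [fuel] for [n]. *)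
Fixpoint expansion_rec (fuel n : nat) : seq 'I_k :=
  if fuel is fuel'.+1 then
    if n == 0%N then [::]
    else rcons (expansion_rec fuel' (n %/ k)) (last_digit n)
  else [::].

Definition expansion (n : nat) : seq 'I_k := expansion_rec n n.

Lemma expansion_recE f n :
  (n <= f)%N -> expansion_rec f n = expansion n.
Proof.
rewrite /expansion; elim/ltn_ind: n f => -[|n] IH [|f] //= le_nf.
have lt_div : (n.+1 %/ k < n.+1)%N by rewrite ltn_Pdiv.
by rewrite !IH // -ltnS (leq_trans lt_div).
Qed.

Lemma expansion0 : expansion 0 = [::].
Proof. by []. Qed.

Lemma expansionS n : (0 < n)%N ->
  expansion n = rcons (expansion (n %/ k)) (last_digit n).
Proof.
case: n => // n _; rewrite {1}/expansion /= expansion_recE //.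
by rewrite -ltnS ltn_Pdiv.
Qed.

End Words.

Record automaton (k : nat) (D : Type) : Type := Automaton {
  state : finType;
  init : state;
  trans : state -> 'I_k -> state;
  output : state -> D
}.

Section Automata.
Variables (k : nat) (D : Type).

(* [foldr] consumes the rightmost digit first. *)
Definition run (M : automaton k D) (s : state M) (w : seq 'I_k) : state M :=
  foldr (fun d t => trans t d) s w.

Lemma run_nil (M : automaton k D) (s : state M) : run s [::] = s.
Proof. by []. Qed.

Lemma run_cat (M : automaton k D) (s : state M) (u v : seq 'I_k) :
  run s (u ++ v) = run (run s v) u.
Proof. exact: foldr_cat. Qed.

Definition automatic (hk : (1 < k)%N) (a : nat -> D) : Prop :=
  exists M : automaton k D,
    forall n, a n = output (run (init M) (expansion hk n)).

End Automata.

Definition average (K : fieldType) (N : nat) (x : nat -> K) : K :=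
  N%:R^-1 * \sum_(n < N) x n.

(* Stated over any [numFieldType] so as to cover both real and complex
   sequences. *)
Definition totally_balanced (K : numFieldType) (a : nat -> K) : Prop :=
  bounded_fun a /\
  forall q r : nat, (0 < q)%N ->
    average N (fun n => a (q * n + r)%N) @[N --> \oo] --> (0 : K).

Definition expi (R : realType) (t : R) : R[i] :=
  (cos (2 * pi * t) +i* sin (2 * pi * t))%C.

Definition fourier_average (R : realType) (a : nat -> R) (N : nat)
    (alpha : R) : R[i] :=
  average N (fun n => (a n)%:C%C * expi (n%:R * alpha)).

(* The supremum is taken in the extended reals, so it carries no default
   value for unbounded sets; [normc] is the real-valued complex modulus. *)
Definition sup_fourier_average (R : realType) (a : nat -> R) (N : nat) :
    \bar R :=
  ereal_sup [set (Normc.normc (fourier_average a N alpha))%:E | alpha in [set: R]].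

(* Main.v *)
Require Import Defs.
From mathcomp Require Import all_boot all_order all_algebra.
From mathcomp Require Import all_classical all_reals all_analysis.
From mathcomp Require Import complex.
From mathcomp Require Import ring lra.
Import Order.TTheory GRing.Theory Num.Theory.
Import numFieldNormedType.Exports.
Local Open Scope ring_scope.

Set Implicit Arguments.
Unset Strict Implicit.
Unset Printing Implicit Defensive.

Local Notation normc := (@Normc.normc _).

(** Write [e(t)] for [exp(2 i pi t)] and [z = e(alpha)].  Up to its value at
    [0], [a] belongs to a finite family [f_1, ..., f_m] closed under passing
    from [g] to [n |-> g(k n + r)]: its kernel.  For [L] a power of [k] this
    closure reads [f_i(L n + r) = f_(D i r)(n)] for [n > 0], so the exponential
    sums [S_i(z, N) = sum_(n < N) z^n f_i(n)] satisfy, up to [O(L)],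

      [S_i(z, N) = sum_(r < L) z^r S_(D i r)(z^L, N / L)],

    which is [expsum_step].  The right-hand side is the operator [twist] applied
    to the vector of the [S_j(z^L, N / L)].  For the sup norm its norm is at
    most [L], which gives only the trivial bound.  The point is that on the span
    [W] of the vectors [(f_i(n))_i], where the vectors of exponential sums live,
    the norm is at most [rho L] for some [rho < 1] independent of [z]
    ([twist_contraction]).  A strong induction on [N] then yields a power saving
    ([expsum_decay]).

    Why the contraction holds: for the norm of [twist] to be nearly [L], all
    summands [z^r w_(D i r)] have to be nearly equal and of nearly maximal
    modulus.  If [L > m], the map [r |-> D i r] takes the same value at some
    [r1 < r2 <= m], so [z^(r2 - r1)] has to be close to [1], and [z] close to a
    root of unity [zeta] of order at most [m].  Total balance handles such
    [zeta]: the sums [S_i(zeta, N)] are [o(N)], and since [W] has finite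
    dimension, the operator for [zeta] has norm at most [L / 2] on [W] as soon
    as [L] is large ([twist_unity_root]).  A perturbation argument extends this
    to [z]. *)

(** * The complex modulus and roots of unity *)

Section Modulus.
Variable R : realType.
Implicit Types (x y z : R[i]).

Lemma normc_real (x : R) : normc (x%:C%C) = `|x|.
Proof. by rewrite /Normc.normc /= expr0n addr0 sqrtr_sqr. Qed.

Lemma normc_ge0 z : 0 <= normc z.
Proof. by case: z => a b; exact: sqrtr_ge0. Qed.

Lemma ler_normcD x y : normc (x + y) <= normc x + normc y.
Proof. exact: le_normcD. Qed.

Lemma normcX z n : normc (z ^+ n) = normc z ^+ n.
Proof.
elim: n => [|n IHn]; first by rewrite !expr0 Normc.normc1.
by rewrite !exprS Normc.normcM IHn.
Qed.

Lemma ler_normc_sum (I : Type) (r : seq I) (P : pred I) (F : I -> R[i]) :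
  normc (\sum_(i <- r | P i) F i) <= \sum_(i <- r | P i) normc (F i).
Proof.
elim/big_rec2: _ => [|i y x _ le_xy]; first by rewrite Normc.normc0.
by rewrite (le_trans (ler_normcD _ _)) // lerD2l.
Qed.

Lemma ler_normc_sum_const n (F : 'I_n -> R[i]) (B : R) :
  (forall i, normc (F i) <= B) -> normc (\sum_i F i) <= n%:R * B.
Proof.
move=> leF; apply: (le_trans (ler_normc_sum _ _ _)).
apply: (le_trans (ler_sum _ (fun i _ => leF i))).
by rewrite sumr_const card_ord mulr_natl.
Qed.

Lemma normc_unity_root z q : (0 < q)%N -> z ^+ q = 1 -> normc z = 1.
Proof.
move=> q_gt0 zq1; apply/eqP; rewrite -(@pexpr_eq1 _ _ q) ?normc_ge0 //.
by rewrite -normcX zq1 Normc.normc1.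
Qed.

Lemma normc_subX (z w : R[i]) n : normc z = 1 -> normc w = 1 ->
  normc (z ^+ n - w ^+ n) <= n%:R * normc (z - w).
Proof.
move=> z1 w1; rewrite subrXX Normc.normcM mulrC ler_wpM2r ?normc_ge0 //.
rewrite -[leRHS]mulr1; apply: ler_normc_sum_const => i.
by rewrite Normc.normcM !normcX z1 w1 !expr1n mulr1.
Qed.

(** If [z] stays at distance [eta] from every [q]-th root of unity, the
    factorisation of [X^q - 1] keeps [z^q] at distance [eta^q] from [1]. *)
Lemma near_unity_root (z : R[i]) q (eta : R) : (0 < q)%N -> 0 <= eta ->
  normc (z ^+ q - 1) < eta ^+ q ->
  exists2 zeta, zeta ^+ q = 1 & normc (z - zeta) < eta.
Proof.
move=> q_gt0 eta_ge0; have [r defr] := closed_field_poly_normal ('X^q - 1 : {poly R[i]}).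
rewrite (monicP (monicXnsubC _ q_gt0)) scale1r in defr.
have szr : size r = q.
  by apply: succn_inj; rewrite -(size_prod_XsubC r id) -defr size_XnsubC.
have eval_r : z ^+ q - 1 = \prod_(zeta <- r) (z - zeta).
  have := congr1 (horner^~ z) defr.
  rewrite !hornerE horner_prod => ->.
  by apply: eq_bigr => zeta _; rewrite !hornerE.
move=> small; have [far|/allPn[zeta r_zeta]] :=
    boolP (all (fun zeta => eta <= normc (z - zeta)) r); last first.
  rewrite -ltNge => near_zeta; exists zeta => //.
  have : root ('X^q - 1) zeta by rewrite defr root_prod_XsubC.
  by rewrite rootE !hornerE subr_eq0 => /eqP.
suff : eta ^+ q <= normc (z ^+ q - 1) by rewrite leNgt small.
rewrite eval_r -szr; elim: {defr szr eval_r small} r far => [|zeta r IHr] /=.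
  by rewrite big_nil expr0 Normc.normc1.
by case/andP=> far /IHr; rewrite big_cons exprS Normc.normcM; apply: ler_pM => //; exact: exprn_ge0.
Qed.

(** The parallelogram identity turns a distance [eta] between two points of
    the unit circle into a loss in the modulus of their sum. *)
Lemma normc_add1_gap (u : R[i]) (eta : R) : normc u = 1 -> 0 <= eta ->
  eta <= normc (u - 1) -> normc (1 + u) <= 2 - eta ^+ 2 / 4.
Proof.
case: u => x y; rewrite /Normc.normc /= => u1 eta_ge0 gap.
have n1 : x ^+ 2 + y ^+ 2 = 1.
  by rewrite -[LHS]sqr_sqrtr ?addr_ge0 ?sqr_ge0 // u1 expr1n.
have gap2 : eta ^+ 2 <= (x - 1) ^+ 2 + (y - 0) ^+ 2.
  rewrite -[leRHS]sqr_sqrtr ?addr_ge0 ?sqr_ge0 //.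
  by rewrite ler_sqr ?nnegrE ?sqrtr_ge0.
have eta2 := sqr_ge0 eta.
have x_ge : -1 <= x by nra.
have rhs_ge0 : 0 <= 2 - eta ^+ 2 / 4 by nra.
rewrite -(ger0_norm rhs_ge0) -sqrtr_sqr; apply: ler_wsqrtr.
move: (eta ^+ 2) gap2 eta2 rhs_ge0 => e; nra.
Qed.

End Modulus.

(** * Spans of sequences of vectors and sums over blocks *)

Section Span.
Variables (K : fieldType) (m : nat) (v : nat -> 'rV[K]_m).

(** The rank of an initial segment of [v] can only grow finitely often, so
    some initial segment spans the whole sequence. *)
Lemma finite_span : exists N : nat, exists G : 'M[K]_(m, N),
  forall n, v n *m G *m (\matrix_(i < N) v i) = v n.
Proof.
pose B N := \matrix_(i < N) v i.
have sub_v i N : (i < N)%N -> (v i <= B N)%MS.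
  by move=> lt_iN; have := row_sub (Ordinal lt_iN) (B N); rewrite rowK.
have sub_B M N : (M <= N)%N -> (B M <= B N)%MS.
  by move=> leMN; apply/row_subP=> i; rewrite rowK sub_v ?(leq_trans _ leMN).
have [||r /asboolP[N rkN] max_r] :=
  @ex_maxnP (fun r => `[< exists N, \rank (B N) = r >]) m.
- by exists (\rank (B 0)); apply/asboolP; exists 0%N.
- by move=> r /asboolP[N <-]; exact: rank_leq_col.
exists N; exists (pinvmx (B N)) => n; apply: mulmxKpV.
pose M := maxn N n.+1.
have le_BM : (B M <= B N)%MS.
  rewrite -(geq_leqif (mxrank_leqif_sup (sub_B _ _ (leq_maxl N n.+1)))) rkN.
  by apply: max_r; apply/asboolP; exists M.
by apply: submx_trans le_BM; apply: sub_v; exact: leq_maxr.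
Qed.

End Span.

Lemma sum_blocks (V : nmodType) (L N : nat) (x : nat -> V) :
  \sum_(n < L * N) x n = \sum_(n < N) \sum_(r < L) x (L * n + r)%N.
Proof.
elim: N => [|N IHN]; first by rewrite muln0 !big_ord0.
by rewrite mulnSr big_split_ord /= IHN big_ord_recr.
Qed.

Lemma sum_blocks_rest (V : nmodType) (L N : nat) (x : nat -> V) :
  \sum_(n < N) x n =
    \sum_(n < N %/ L) \sum_(r < L) x (L * n + r)%N +
    \sum_(r < N %% L) x (L * (N %/ L) + r)%N.
Proof.
rewrite -sum_blocks -(big_mkord xpredT x) {1}(divn_eq N L) mulnC.
by rewrite big_mkord big_split_ord.
Qed.

(** * Kernel families and their sums along roots of unity *)

Lemma finite_bound (R : realType) (I : finType) (P : I -> R -> Prop) :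
  (forall i c d, c <= d -> P i c -> P i d) ->
  (forall i, exists c, P i c) -> exists2 C, 0 <= C & forall i, P i C.
Proof.
move=> mono /choice[c Pc]; exists (\sum_i `|c i|).
  by apply: sumr_ge0 => i _; exact: normr_ge0.
move=> i; apply: mono (Pc i); apply: (le_trans (ler_norm _)).
by rewrite (bigD1 i) //= lerDl sumr_ge0.
Qed.

(** The sums are [o(N)], in the form that is stable under finite changes of the
    sequence and under sums over finitely many sequences. *)
Definition small_sums {R : realType} (x : nat -> R) : Prop :=
  forall eps : R, 0 < eps -> exists C : R, forall N : nat,
    `|\sum_(n < N) x n| <= eps * N%:R + C.

(** The value at [0] is left out because the expansion of [0] is empty: reading
    a leading zero may change the state of an automaton. *)
Definition kernel_closed {R : realType} {m} (k : nat) (f : 'I_m -> nat -> R) :=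
  forall (i : 'I_m) (r : nat), (r < k)%N ->
    exists j, forall n, (0 < n)%N -> f i (k * n + r)%N = f j n.

Section KernelFamily.
Variables (R : realType) (m : nat) (f : 'I_m -> nat -> R).
Implicit Types (z : R[i]) (w : 'rV[R[i]]_m) (L n N : nat) (i : 'I_m)
  (D : 'I_m -> nat -> 'I_m).

Lemma kernel_closed_exp k l : (0 < k)%N ->
  kernel_closed k f -> kernel_closed (k ^ l) f.
Proof.
move=> k_gt0 f_k; elim: l => [|l IHl] i r.
  by rewrite ltnS leqn0 => /eqP->; exists i => n _; rewrite mul1n addn0.
move=> lt_r; have [j fj] := f_k i (r %% k)%N (ltn_pmod _ k_gt0).
have [|j' fj'] := IHl j (r %/ k)%N; first by rewrite ltn_divLR // -expnSr.
exists j' => n n_gt0; rewrite -fj' // -fj ?addn_gt0 ?muln_gt0 ?expn_gt0 ?k_gt0 ?n_gt0 //.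
by congr (f i _); rewrite {1}(divn_eq r k) expnS mulnDr mulnA addnA [(_ %/ _ * _)%N]mulnC.
Qed.

Lemma kernel_trans L : kernel_closed L f ->
  exists D : 'I_m -> nat -> 'I_m, forall i r n,
    (r < L)%N -> (0 < n)%N -> f i (L * n + r)%N = f (D i r) n.
Proof.
move=> f_L; pose P (ir : 'I_m * nat) j :=
  (ir.2 < L)%N -> forall n, (0 < n)%N -> f ir.1 (L * n + ir.2)%N = f j n.
have /choice[D PD] : forall ir, exists j, P ir j.
  case=> i r; have [lt_r|ge_r] := ltnP r L; last first.
    by exists i; rewrite /P ltnNge ge_r.
  by have [j fj] := f_L i r lt_r; exists j => _.
by exists (fun i r => D (i, r)) => i r n lt_r; exact: (PD (i, r)).
Qed.

Variable A : R.
Hypothesis f_bounded : forall i n, `|f i n| <= A.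
Hypothesis f_balanced : forall i q r, (0 < q)%N ->
  small_sums (fun n => f i (q * n + r)%N).

Definition expsum (z : R[i]) (N : nat) (i : 'I_m) : R[i] :=
  \sum_(n < N) z ^+ n * (f i n)%:C%C.

Let A_ge0 (i : 'I_m) : 0 <= A.
Proof. exact: le_trans (normr_ge0 _) (f_bounded i 0). Qed.

Lemma normc_term z i n p : normc z = 1 -> normc (z ^+ p * (f i n)%:C%C) <= A.
Proof. by move=> z1; rewrite Normc.normcM normcX z1 expr1n mul1r normc_real. Qed.

(** For a root of unity of order at most [m] the exponential sum splits into
    sums along residue classes, which are small by balance. *)
Lemma expsum_unity_root (eps : R) : 0 < eps -> exists2 C : R, 0 <= C &
  forall i q z N, (0 < q <= m)%N -> z ^+ q = 1 ->
    normc (expsum z N i) <= eps * N%:R + C.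
Proof.
move=> eps_gt0.
pose P (t : 'I_m * 'I_m.+1 * 'I_m) (C : R) := (0 < t.1.2)%N -> forall N,
  `|\sum_(n < N) f t.1.1 (t.1.2 * n + t.2)%N| <= eps * N%:R + C.
have [||C C_ge0 PC] := @finite_bound _ _ P.
- move=> t c d le_cd Pc q_gt0 N; apply: (le_trans (Pc q_gt0 N)).
  by rewrite lerD2l.
- move=> [[i q] r]; rewrite /P /=; case: posnP => [_|q_gt0]; first by exists 0.
  by have [C HC] := f_balanced i r q_gt0 eps_gt0; exists C.
exists (m%:R * (C + `|A|)) => [|i q z N /andP[q_gt0 le_qm] zq1].
  by rewrite mulr_ge0 ?addr_ge0 ?normr_ge0 ?ler0n.
have z1 := normc_unity_root q_gt0 zq1.
rewrite /expsum (sum_blocks_rest q N (fun n => z ^+ n * (f i n)%:C%C)) exchange_big /=.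
apply: (le_trans (ler_normcD _ _)).
have le1 : normc (\sum_(r < q) \sum_(n < N %/ q)
    z ^+ (q * n + r) * (f i (q * n + r)%N)%:C%C) <=
    q%:R * (eps * (N %/ q)%:R + C).
  apply: ler_normc_sum_const => r.
  have -> : \sum_(n < N %/ q) z ^+ (q * n + r) * (f i (q * n + r)%N)%:C%C =
      z ^+ r * (\sum_(n < N %/ q) f i (q * n + r)%N)%:C%C.
    rewrite rmorph_sum mulr_sumr; apply: eq_bigr => n _.
    by rewrite exprD exprM zq1 expr1n mul1r.
  rewrite Normc.normcM normcX z1 expr1n mul1r normc_real.
  have lt_qm : (q < m.+1)%N by [].
  have lt_rm : (r < m)%N by apply: leq_trans le_qm.
  exact: (PC (i, Ordinal lt_qm, Ordinal lt_rm) q_gt0).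
have le2 : normc (\sum_(r < N %% q)
    z ^+ (q * (N %/ q) + r) * (f i (q * (N %/ q) + r)%N)%:C%C) <=
    (N %% q)%:R * A.
  by apply: ler_normc_sum_const => r; exact: normc_term.
apply: (le_trans (lerD le1 le2)).
have le_qN : q%:R * (N %/ q)%:R <= N%:R :> R.
  by rewrite -natrM ler_nat mulnC leq_trunc_div.
have le_qm' : q%:R <= m%:R :> R by rewrite ler_nat.
have le_rm : (N %% q)%:R <= m%:R :> R.
  by rewrite ler_nat (leq_trans (ltnW (ltn_pmod _ q_gt0))).
rewrite (ger0_norm (A_ge0 i)).
have h1 := ler_wpM2r C_ge0 le_qm'.
have h2 := ler_wpM2r (A_ge0 i) le_rm.
have h3 := ler_wpM2l (ltW eps_gt0) le_qN.
by nra.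
Qed.

(** * The transfer operator *)

Definition digit_map (L : nat) (D : 'I_m -> nat -> 'I_m) : Prop :=
  forall i r n, (r < L)%N -> (0 < n)%N -> f i (L * n + r)%N = f (D i r) n.

(** The linear operator that expresses exponential sums of length [L N] at [z]
    through those of length [N] at [z ^+ L]. *)
Definition twist (L : nat) (D : 'I_m -> nat -> 'I_m) (z : R[i])
    (w : 'rV[R[i]]_m) (i : 'I_m) : R[i] :=
  \sum_(r < L) z ^+ r * w 0 (D i r).

Definition vec (n : nat) : 'rV[R[i]]_m := \row_i (f i n)%:C%C.

Lemma twist_sum L D z (I : finType) (c : I -> R[i]) (u : I -> 'rV[R[i]]_m) i :
  twist L D z (\sum_j c j *: u j) i = \sum_j c j * twist L D z (u j) i.
Proof.
rewrite /twist; under eq_bigr => r _ do rewrite summxE mulr_sumr.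
rewrite exchange_big /=; apply: eq_bigr => j _; rewrite mulr_sumr.
by apply: eq_bigr => r _; rewrite mxE mulrCA.
Qed.

Lemma twist_vec L D z n i : digit_map L D -> (0 < n)%N ->
  twist L D z (vec n) i = \sum_(r < L) z ^+ r * (f i (L * n + r)%N)%:C%C.
Proof. by move=> LD n_gt0; apply: eq_bigr => r _; rewrite mxE LD. Qed.

(** The operator turns [vec n] into a stretch of the exponential sum, which is
    what lets balance of the family act on it. *)
Lemma twist_vec_expsum L D z n i : digit_map L D -> (0 < n)%N ->
  z ^+ (L * n) * twist L D z (vec n) i = expsum z (L * n.+1) i - expsum z (L * n) i.
Proof.
move=> LD n_gt0; rewrite (twist_vec _ _ LD n_gt0) /expsum mulnSr big_split_ord /=.
rewrite addrAC subrr add0r mulr_sumr.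
by apply: eq_bigr => r _; rewrite exprD mulrA.
Qed.

Hypothesis f0 : forall i, f i 0%N = 0.

(* The rows [vec i] with [i < N0] span all the [vec n], and [G] computes
   coefficients with respect to them. *)
Variables (N0 : nat) (G : 'M[R[i]]_(m, N0)).
Hypothesis vec_span : forall n, vec n *m G *m (\matrix_(i < N0) vec i) = vec n.

Definition spanned (w : 'rV[R[i]]_m) : Prop :=
  w *m G *m (\matrix_(i < N0) vec i) = w.

(** A vector [w] of the span is a combination of the finitely many [vec j] with
    [j < N0], with coefficients bounded by the sup norm of [w]; each [vec j] is
    sent to a difference of two exponential sums at a root of unity, which is
    [o(L)]. *)
Lemma twist_unity_root : exists L0 : nat, forall L D,
  (L0 <= L)%N -> digit_map L D -> forall w M, spanned w ->
  (forall t, normc (w 0 t) <= M) -> forall q z i, (0 < q <= m)%N -> z ^+ q = 1 ->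
  normc (twist L D z w i) <= L%:R / 2 * M.
Proof.
pose Gam := \sum_t \sum_j normc (G t j).
have Gam_ge0 : 0 <= Gam by do 2!apply: sumr_ge0 => ? _; exact: normc_ge0.
pose K := N0%:R * Gam * (N0%:R * 2).
have K_ge0 : 0 <= K by rewrite !mulr_ge0.
pose eps := (4 * (K + 1))^-1.
have eps_gt0 : 0 < eps by rewrite invr_gt0; lra.
have [C C_ge0 small] := expsum_unity_root eps_gt0.
(* [eps] and [X] make the two error terms at most a quarter of [L * M] each *)
pose X := 8 * (N0%:R * Gam * C).
exists (Num.trunc X).+1 => L D le_L LD w M w_span w_le q z i q_le zq1.
have ltXL : X <= L%:R.
  by apply: (le_trans (ltW (truncnS_gt X))); rewrite ler_nat.
have z1 : normc z = 1 by case/andP: q_le => q_gt0 _; exact: normc_unity_root zq1.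
have M_ge0 : 0 <= M := le_trans (normc_ge0 _) (w_le i).
have coef_le j : normc ((w *m G) 0 j) <= M * Gam.
  rewrite mxE; apply: (le_trans (ler_normc_sum _ _ _)).
  rewrite mulr_sumr; apply: ler_sum => t _; rewrite Normc.normcM.
  apply: ler_pM; rewrite ?normc_ge0 //.
  by rewrite (bigD1 j) //= lerDl sumr_ge0 // => ? _; exact: normc_ge0.
have vec_le (j : 'I_N0) : normc (twist L D z (vec j) i) <=
    eps * L%:R * (N0%:R * 2) + 2 * C.
  have [j0|j_gt0] := posnP j.
    have -> : twist L D z (vec j) i = 0.
      by apply: big1 => r _; rewrite mxE j0 f0 mulr0.
    by rewrite Normc.normc0 addr_ge0 ?mulr_ge0 // ltW.
  rewrite -[normc _]mul1r -{1}(expr1n _ (L * j)) -{1}z1 -normcX -Normc.normcM.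
  rewrite (twist_vec_expsum _ _ LD j_gt0); apply: (le_trans (ler_normcD _ _)).
  rewrite normcN.
  apply: (le_trans (lerD (small i q z _ q_le zq1) (small i q z _ q_le zq1))).
  have le_n n : (n <= N0)%N -> eps * (L * n)%:R <= eps * L%:R * N0%:R.
    by move=> le_n; rewrite natrM -mulrA !ler_wpM2l ?ler_nat // ltW.
  have := le_n j (ltnW (ltn_ord j)); have := le_n j.+1 (ltn_ord j); lra.
have -> : w = \sum_j (w *m G) 0 j *: vec j.
  rewrite -{1}w_span {1}mulmx_sum_row; apply: eq_bigr => j _.
  by rewrite rowK.
rewrite twist_sum.
apply: (@le_trans _ _ (N0%:R * (M * Gam * (eps * L%:R * (N0%:R * 2) + 2 * C)))).
  apply: ler_normc_sum_const => j; rewrite Normc.normcM.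
  by apply: ler_pM; rewrite ?normc_ge0.
have epsK : eps * K <= 1 / 4.
  have -> : eps * K = 1/4 * (K / (K + 1)) by rewrite /eps; field; lra.
  by rewrite ler_piMr // ler_pdivrMr; lra.
have -> : N0%:R * (M * Gam * (eps * L%:R * (N0%:R * 2) + 2 * C)) =
   M * (eps * K * L%:R + X / 4) by rewrite /K /X; field.
rewrite mulrC ler_wpM2r //.
have := ler_wpM2r (ler0n R L) epsK; lra.
Qed.

Lemma twist_perturb L D z z' w M i : normc z = 1 -> normc z' = 1 ->
  (forall t, normc (w 0 t) <= M) ->
  normc (twist L D z w i - twist L D z' w i) <=
    L%:R * (L%:R * normc (z - z') * M).
Proof.
move=> z1 z'1 w_le; rewrite /twist -sumrB; apply: ler_normc_sum_const => r.
rewrite -mulrBl Normc.normcM ler_pM ?normc_ge0 //.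
apply: (le_trans (normc_subX _ z1 z'1)).
by rewrite ler_wpM2r ?normc_ge0 // ler_nat ltnW.
Qed.

(** Two summands carrying the same entry of [w] interfere with phase
    [z ^+ (r2 - r1)], so they cannot both add up to full modulus unless this
    phase is near [1]. *)
Lemma twist_collision L D z w M eta i (r1 r2 : 'I_L) : normc z = 1 -> 0 <= eta ->
  (forall t, normc (w 0 t) <= M) -> (r1 < r2)%N -> D i r1 = D i r2 ->
  eta <= normc (z ^+ (r2 - r1) - 1) ->
  normc (twist L D z w i) <= (L%:R - eta ^+ 2 / 4) * M.
Proof.
move=> z1 eta_ge0 w_le lt_r eqD gap.
have M_ge0 : 0 <= M := le_trans (normc_ge0 _) (w_le i).
have ne_r : r2 != r1 by rewrite -val_eqE /= gtn_eqF.
rewrite /twist (bigD1 r1) //= (bigD1 r2) //= addrA -eqD.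
apply: (le_trans (ler_normcD _ _)).
have -> : z ^+ r1 * w 0 (D i r1) + z ^+ r2 * w 0 (D i r1) =
    z ^+ r1 * w 0 (D i r1) * (1 + z ^+ (r2 - r1)).
  by rewrite -{1}(subnKC (ltnW lt_r)) exprD; ring.
have pair_le : normc (z ^+ r1 * w 0 (D i r1) * (1 + z ^+ (r2 - r1))) <=
    M * (2 - eta ^+ 2 / 4).
  rewrite !Normc.normcM normcX z1 expr1n mul1r ler_pM ?normc_ge0 //.
  by apply: normc_add1_gap => //; rewrite normcX z1 expr1n.
have rest_le : normc (\sum_(r < L | (r != r1) && (r != r2)) z ^+ r * w 0 (D i r)) <=
    (L%:R - 2) * M.
  apply: (le_trans (ler_normc_sum _ _ _)).
  have -> : (L%:R - 2) * M = \sum_(r < L | (r != r1) && (r != r2)) M.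
    have : \sum_(r < L) M = L%:R * M by rewrite sumr_const card_ord mulr_natl.
    rewrite (bigD1 r1) //= (bigD1 r2) //=; lra.
  apply: ler_sum => r _.
  by rewrite Normc.normcM normcX z1 expr1n mul1r.
by apply: (le_trans (lerD pair_le rest_le)); lra.
Qed.

(** Two digits [r1 < r2 <= m] collide under [D i].  Either the phase between
    them is away from [1], and [twist_collision] gains, or [z] is within [del]
    of a root of unity of order at most [m], and the bound of
    [twist_unity_root] survives the perturbation. *)
Lemma twist_contraction : exists L0 : nat, forall L D,
  (L0 <= L)%N -> digit_map L D -> exists2 rho : R, 3 / 4 <= rho < 1 &
  forall z w M i, normc z = 1 -> spanned w -> (forall t, normc (w 0 t) <= M) ->
    normc (twist L D z w i) <= rho * L%:R * M.
Proof.
have [L0 half] := twist_unity_root.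
exists (maxn L0 m.+1) => L D; rewrite geq_max => /andP[le_L0 lt_mL] LD.
have L_gt0 : 0 < L%:R :> R by rewrite ltr0n (leq_trans _ lt_mL).
have L_ge1 : 1 <= L%:R :> R by rewrite ler1n (leq_trans _ lt_mL).
(* [del] is such that the perturbation costs at most [L / 4]; [eta] is the
   threshold of [near_unity_root] for the largest order, [m] *)
pose del : R := (4 * L%:R)^-1.
have del_gt0 : 0 < del by rewrite invr_gt0; lra.
have delL : del * L%:R = 1 / 4 by rewrite /del; field; lra.
have del_le1 : del <= 1 by nra.
pose eta := del ^+ m.
have eta_gt0 : 0 < eta by exact: exprn_gt0.
have gain_gt0 : 0 < eta ^+ 2 / 4 / L%:R.
  by rewrite divr_gt0 // divr_gt0 ?exprn_gt0 // ltr0n.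
exists (Num.max (3 / 4) (1 - eta ^+ 2 / 4 / L%:R)).
  by rewrite le_max lexx gt_max; apply/andP; split; lra.
move=> z w M i z1 w_span w_le.
have M_ge0 : 0 <= M := le_trans (normc_ge0 _) (w_le i).
set rho := Num.max _ _.
have rho_ge34 : 3 / 4 <= rho by rewrite le_max lexx.
have rho_ge : L%:R - eta ^+ 2 / 4 <= rho * L%:R.
  have : 1 - eta ^+ 2 / 4 / L%:R <= rho by rewrite le_max lexx orbT.
  move/(ler_wpM2r (ltW L_gt0)); apply: le_trans.
  by rewrite mulrBl mul1r divfK // gt_eqF.
have [r1 [r2 [lt_r le_r2 eqD]]] : exists r1 r2 : 'I_L,
    [/\ (r1 < r2)%N, (r2 <= m)%N & D i r1 = D i r2].
  have /injectivePn[p1 [p2 ne_p eqD]] :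
      ~~ injectiveb (fun p : 'I_m.+1 => D i p).
    by apply/negP => /injectiveP/leq_card; rewrite !card_ord ltnn.
  have lt_pL (p : 'I_m.+1) : (p < L)%N by exact: leq_trans (ltn_ord p) lt_mL.
  wlog lt_p : p1 p2 ne_p eqD / (p1 < p2)%N => [wlog_lt|].
    have [||eq_p] := ltngtP p1 p2; first exact: wlog_lt.
      by apply: wlog_lt; rewrite 1?eq_sym.
    by case/eqP: ne_p; apply: val_inj.
  exists (Ordinal (lt_pL p1)), (Ordinal (lt_pL p2)); split=> //=.
  by rewrite -ltnS.
have [far|near1] := lerP eta (normc (z ^+ (r2 - r1) - 1)).
  apply: (le_trans (twist_collision z1 (ltW eta_gt0) w_le lt_r eqD far)).
  by rewrite ler_wpM2r.
have q_bounds : (0 < r2 - r1 <= m)%N.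
  by rewrite subn_gt0 lt_r (leq_trans (leq_subr _ _)).
have [|||zeta zetaq near_z] := @near_unity_root _ z (r2 - r1) del.
- by case/andP: q_bounds.
- exact: ltW.
- apply: (lt_le_trans near1); apply: ler_wiXn2l; rewrite ?(ltW del_gt0) //.
  by case/andP: q_bounds.
have zeta1 : normc zeta = 1.
  by apply: normc_unity_root zetaq; case/andP: q_bounds.
have := half L D le_L0 LD w M w_span w_le _ zeta i q_bounds zetaq.
have := twist_perturb L D i z1 zeta1 w_le.
have := ler_normcD (twist L D zeta w i) (twist L D z w i - twist L D zeta w i).
rewrite addrC subrK.
have pert : L%:R * (L%:R * normc (z - zeta) * M) <= L%:R / 4 * M.
  have -> : L%:R / 4 * M = L%:R * (L%:R * del * M) by rewrite (mulrC L%:R del) delL; ring.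
  by rewrite ler_wpM2l ?(ltW L_gt0) // ler_wpM2r // ler_wpM2l ?(ltW L_gt0) // ltW.
have main : 3 / 4 * L%:R * M <= rho * L%:R * M.
  by rewrite ler_wpM2r // ler_wpM2r // ltW.
lra.
Qed.

(** * Power saving for kernel families *)

Definition expsum_row (z : R[i]) (N : nat) : 'rV[R[i]]_m :=
  \row_i expsum z N i.

Lemma spanned_expsum z N : spanned (expsum_row z N).
Proof.
have -> : expsum_row z N = \sum_(n < N) z ^+ n *: vec n.
  apply/rowP=> i; rewrite mxE summxE; apply: eq_bigr => n _.
  by rewrite !mxE.
rewrite /spanned !mulmx_suml; apply: eq_bigr => n _.
by rewrite -!scalemxAl vec_span.
Qed.

(** The two error terms are the block [n = 0] and the incomplete last block. *)
Lemma expsum_step L D z N i : (0 < L)%N -> digit_map L D -> normc z = 1 ->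
  normc (expsum z N i - twist L D z (expsum_row (z ^+ L) (N %/ L)) i) <=
    L%:R * A + L%:R * A.
Proof.
move=> L_gt0 LD z1.
rewrite /expsum (sum_blocks_rest L N (fun n => z ^+ n * (f i n)%:C%C)).
rewrite /twist; under [X in _ - X]eq_bigr => r _ do rewrite mxE /expsum mulr_sumr.
rewrite [X in _ - X]exchange_big /= addrAC -sumrB.
apply: (le_trans (ler_normcD _ _)); apply: lerD; last first.
  apply: (@le_trans _ _ ((N %% L)%:R * A)).
    by apply: ler_normc_sum_const => r; exact: normc_term.
  by rewrite ler_wpM2r ?A_ge0 // ler_nat ltnW // ltn_mod.
(* only the block [n = 0] fails the kernel identity *)
case: (N %/ L)%N => [|N'].
  by rewrite big_ord0 Normc.normc0 mulr_ge0 ?(A_ge0 i).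
rewrite big_ord_recl [X in _ + X]big1 ?addr0 => [|n _]; last first.
  rewrite -sumrB big1 // => r _.
  by rewrite LD // exprD exprM; ring.
rewrite [X in _ - X]big1 ?subr0 => [|r _]; last by rewrite f0 !mulr0.
by apply: ler_normc_sum_const => r; exact: normc_term.
Qed.

(** With [lam = rho * L] the recursion is [S(N) <= lam * S(N / L) + O(L)], and
    [theta] is chosen so that [L ^ theta = lam].  Subtracting the constant [E]
    in the induction hypothesis absorbs the error term, because [lam > 1]. *)
Lemma expsum_decay k (i0 : 'I_m) : (1 < k)%N -> kernel_closed k f ->
  exists2 theta : R, 0 <= theta < 1 & exists2 C : R, 0 <= C &
    forall N z i, (0 < N)%N -> normc z = 1 ->
      normc (expsum z N i) <= C * N%:R `^ theta.
Proof.
move=> k_gt1 f_k; have [L0 contract] := twist_contraction.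
have A0 := A_ge0 i0.
pose L := (k ^ L0.+1)%N.
have le_L0 : (L0 <= L)%N by rewrite ltnW // ltnW // ltn_expl.
have L_gt1 : (1 < L)%N by rewrite -(exp1n L0.+1) ltn_exp2r.
have L_gt0 : (0 < L)%N by exact: ltnW.
have LR_gt1 : 2 <= L%:R :> R by rewrite ler_nat.
have [D LD] := kernel_trans (kernel_closed_exp (l := L0.+1) (ltnW k_gt1) f_k).
have [rho /andP[rho_ge rho_lt1] contr] := contract L D le_L0 LD.
pose lam := rho * L%:R.
have lam_gt1 : 1 < lam by rewrite /lam; nra.
have lam_lt : lam < L%:R by rewrite /lam; nra.
have lnL : 0 < ln (L%:R : R) by rewrite ln_gt0 //; lra.
pose theta := ln lam / ln (L%:R : R).
have L_theta : L%:R `^ theta = lam.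
  rewrite /powR gt_eqF; last lra.
  by rewrite /theta divfK ?gt_eqF // lnK // posrE; lra.
have theta_ge0 : 0 <= theta by apply: divr_ge0; [apply: ln_ge0; exact: ltW | exact: ltW].
exists theta.
  rewrite theta_ge0 /=.
  by rewrite ltr_pdivrMr // mul1r ltr_ln // posrE; lra.
pose E := 2 * L%:R * A / (lam - 1).
have E_ge0 : 0 <= E by rewrite divr_ge0 ?mulr_ge0 //; lra.
have E_lam : E * (lam - 1) = 2 * L%:R * A by rewrite /E; field; lra.
have LA_ge0 : 0 <= L%:R * A by rewrite mulr_ge0.
exists (E + L%:R * A); first exact: addr_ge0.
suff bound N z i : (0 < N)%N -> normc z = 1 ->
    normc (expsum z N i) <= (E + L%:R * A) * N%:R `^ theta - E.
  move=> N z i N_gt0 z1; have := bound N z i N_gt0 z1; lra.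
elim/ltn_ind: N z i => N IHN z i N_gt0 z1.
have [lt_NL|le_LN] := ltnP N L.
  have N_theta : 1 <= N%:R `^ theta.
    by rewrite -[leLHS](powRr0 (N%:R : R)) ler_powR // ler1n.
  have : normc (expsum z N i) <= L%:R * A.
    apply: (@le_trans _ _ (N%:R * A)).
      by apply: ler_normc_sum_const => n; exact: normc_term.
    by rewrite ler_wpM2r // ler_nat ltnW.
  by have := ler_wpM2l (addr_ge0 E_ge0 LA_ge0) N_theta; lra.
have Q_gt0 : (0 < N %/ L)%N by rewrite divn_gt0.
have lt_QN : (N %/ L < N)%N by rewrite ltn_Pdiv.
have zL1 : normc (z ^+ L) = 1 by rewrite normcX z1 expr1n.
have Q_theta : lam * (N %/ L)%:R `^ theta <= N%:R `^ theta.
  rewrite -L_theta -powRM // -natrM; apply: ge0_ler_powR => //; rewrite ?nnegrE //.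
  by rewrite ler_nat mulnC leq_trunc_div.
set T := twist L D z (expsum_row (z ^+ L) (N %/ L)) i.
have main : normc T <= lam * ((E + L%:R * A) * (N %/ L)%:R `^ theta - E).
  by apply: contr => // [|t]; [exact: spanned_expsum|rewrite mxE; exact: IHN].
have step : normc (expsum z N i - T) <= L%:R * A + L%:R * A.
  exact: expsum_step.
have := ler_normcD (expsum z N i - T) T; rewrite subrK.
have := ler_wpM2l (addr_ge0 E_ge0 LA_ge0) Q_theta.
lra.
Qed.

End KernelFamily.

(** * The kernel of an automatic sequence *)

Section Automatic.
Variables (R : realType) (k : nat) (hk : (1 < k)%N) (a : nat -> R).

Lemma expansion_digit n r : (0 < n)%N -> forall lt_rk : (r < k)%N,
  expansion hk (k * n + r) = rcons (expansion hk n) (Ordinal lt_rk).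
Proof.
move=> n_gt0 lt_rk; have k_gt0 := ltnW hk.
rewrite expansionS ?addn_gt0 ?muln_gt0 ?k_gt0 ?n_gt0 //.
rewrite mulnC divnMDl // (divn_small lt_rk) addn0; congr rcons.
by apply: val_inj; rewrite /= modnMDl modn_small.
Qed.

(** Setting the value at [0] to [0] makes the block [n = 0] of [expsum_step]
    vanish on one side, and changes sums by a bounded amount. *)
Definition kernel_member (g : nat -> R) : Prop :=
  g 0%N = 0 /\ exists j u : nat, forall n, (0 < n)%N -> g n = a (k ^ j * n + u)%N.

(** The family is indexed by the states whose output sequence is, away from
    [0], in the kernel of [a]; the initial state is one of them, and they are
    stable under transitions.  States outside this set are dropped, since
    balance of [a] says nothing about them. *)
Lemma automatic_kernel : automatic hk a ->
  exists m : nat, exists f : 'I_m -> nat -> R, exists i0 : 'I_m,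
    [/\ forall n, (0 < n)%N -> f i0 n = a n, forall i, kernel_member (f i) &
        kernel_closed k f].
Proof.
case=> M aE.
pose g (s : state M) (n : nat) : R :=
  if n == 0%N then 0 else output (run s (expansion hk n)).
pose reached (s : state M) := `[< kernel_member (g s) >].
pose S := {s : state M | reached s}.
have init_reached : reached (init M).
  apply/asboolP; split=> //; exists 0%N, 0%N => n n_gt0.
  by rewrite /g gtn_eqF // mul1n addn0 aE.
have g_trans s r (lt_rk : (r < k)%N) n : (0 < n)%N ->
    g s (k * n + r)%N = g (trans s (Ordinal lt_rk)) n.
  move=> n_gt0; rewrite /g !gtn_eqF ?addn_gt0 ?muln_gt0 ?(ltnW hk) ?n_gt0 //.
  by rewrite (expansion_digit n_gt0 lt_rk) /run foldr_rcons.
have trans_reached s d : reached s -> reached (trans s d).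
  move=> /asboolP[_ [j [u gE]]]; apply/asboolP; split=> //.
  exists j.+1, (k ^ j * d + u)%N => n n_gt0.
  have -> : trans s d = trans s (Ordinal (ltn_ord d)) by congr trans; apply: val_inj.
  rewrite -g_trans // gE ?addn_gt0 ?muln_gt0 ?(ltnW hk) ?n_gt0 //.
  by rewrite mulnDr mulnA -expnSr addnA.
exists #|{: S}|, (fun i => g (val (enum_val i : S))).
exists (enum_rank (Sub (init M) init_reached : S)); split.
- by move=> n n_gt0; rewrite enum_rankK /= /g gtn_eqF // aE.
- by move=> i; case: (enum_val i) => s s_reached /=; exact/asboolP.
move=> i r lt_rk; case: (enum_val i) => s s_reached /=.
exists (enum_rank (Sub (trans s (Ordinal lt_rk)) (trans_reached s _ s_reached) : S)).
by move=> n n_gt0; rewrite enum_rankK /= g_trans.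
Qed.

Lemma average_small_sums (x : nat -> R) (A : R) : (forall n, `|x n| <= A) ->
  (average N x @[N --> \oo] --> (0 : R))%classic -> small_sums x.
Proof.
move=> x_le avg0 eps eps_gt0.
have /= [N1 _ HN1] := @cvgr0_norm_le _ _ _ _ _ _ avg0 _ eps_gt0.
exists (N1%:R * A) => N.
have A_ge0 : 0 <= A := le_trans (normr_ge0 _) (x_le 0%N).
have [le_N|lt_N] := leqP N1 N; last first.
  apply: (le_trans (ler_norm_sum _ _ _)).
  apply: (le_trans (ler_sum _ (fun n _ => x_le _))).
  rewrite sumr_const card_ord -(mulr_natl A) ler_wpDl ?mulr_ge0 ?(ltW eps_gt0) //.
  by rewrite ler_wpM2r // ler_nat ltnW.
have [->|N_gt0] := posnP N; first by rewrite big_ord0 normr0 mulr0 add0r mulr_ge0.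
have := HN1 N le_N; rewrite /average normrM ger0_norm ?invr_ge0 //.
rewrite mulrC ler_pdivrMr ?ltr0n // => /le_trans; apply.
by rewrite lerDl mulr_ge0.
Qed.

Lemma kernel_member_small_sums (A : R) (g : nat -> R) (q r : nat) :
  (forall n, `|a n| <= A) -> totally_balanced a -> kernel_member g -> (0 < q)%N ->
  small_sums (fun n => g (q * n + r)%N).
Proof.
move=> a_le [_ bal] [g0 [j [u gE]]] q_gt0 eps eps_gt0.
pose x n := a ((k ^ j * q) * n + (k ^ j * r + u))%N.
have x_small : small_sums x.
  apply: (@average_small_sums _ A) => [n|]; first exact: a_le.
  by apply: bal; rewrite muln_gt0 expn_gt0 (ltnW hk) q_gt0.
have [C HC] := x_small _ eps_gt0; exists (C + (A + A)) => N.
have A_ge0 : 0 <= A := le_trans (normr_ge0 _) (a_le 0%N).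
have g_le n : `|g n| <= A.
  by case: n => [|n]; [rewrite g0 normr0 | rewrite gE].
have -> : \sum_(n < N) g (q * n + r)%N =
    \sum_(n < N) x n + \sum_(n < N) (g (q * n + r)%N - x n).
  by rewrite -big_split; apply: eq_bigr => n _; rewrite /= addrC subrK.
apply: (le_trans (ler_normD _ _)); rewrite addrA; apply: lerD; first exact: HC.
case: N {HC} => [|N]; first by rewrite big_ord0 normr0 addr_ge0.
rewrite big_ord_recl big1 ?addr0 => [|n _].
  by apply: (le_trans (ler_normB _ _)); apply: lerD; [exact: g_le|exact: a_le].
rewrite gE ?addn_gt0 ?muln_gt0 ?q_gt0 // /x mulnDr -!mulnA addnA subrr //.
Qed.

End Automatic.

(** * Fourier averages as exponential sums *)

Section Exponential.
Variable R : realType.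
Implicit Types t : R.

Lemma expiD t u : expi (t + u) = expi t * expi u.
Proof.
rewrite /expi mulrDr cosD sinD; apply/eqP; rewrite eq_complex /=.
by rewrite eqxx /= addrC [X in _ == X + _]mulrC [X in _ == _ + X]mulrC; apply/eqP; ring.
Qed.

Lemma expi_nat n t : expi (n%:R * t) = expi t ^+ n.
Proof.
elim: n => [|n IHn]; last by rewrite -natr1 mulrDl mul1r expiD IHn exprSr.
by rewrite mul0r /expi mulr0 cos0 sin0 expr0.
Qed.

Lemma normc_expi t : normc (expi t) = 1.
Proof. by rewrite /expi /Normc.normc cos2Dsin2 sqrtr1. Qed.

End Exponential.

Theorem proposition8p1 (R : realType) (k : nat) (hk : (1 < k)%N)
    (a : nat -> R) (ha_aut : automatic hk a) (ha_bal : totally_balanced a) :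
  exists2 c : R, 0 < c &
    exists C : R, forall N : nat, (0 < N)%N ->
      (sup_fourier_average a N <= (C * (N%:R `^ (- c)))%:E)%E.
Proof.
have [A a_le] : exists A : R, forall n, `|a n| <= A.
  case: ha_bal => /pinfty_ex_gt0[A _ a_le] _; exists A => n; exact: a_le.
have [m [f [i0 [f_i0 f_mem f_k]]]] := automatic_kernel ha_aut.
have f_le i n : `|f i n| <= A.
  case: (f_mem i) => f0 [j [u fE]]; case: n => [|n]; last by rewrite fE.
  by rewrite f0 normr0 (le_trans (normr_ge0 _) (a_le 0%N)).
have f_bal i q r : (0 < q)%N -> small_sums (fun n => f i (q * n + r)%N).
  by move=> q_gt0; exact: kernel_member_small_sums (f_mem i) q_gt0.
have [N0 [G vec_span]] := finite_span (vec f).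
have [theta /andP[theta_ge0 theta_lt1] [C C_ge0 decay]] :=
  expsum_decay f_le f_bal (fun i => proj1 (f_mem i)) vec_span i0 hk f_k.
exists (1 - theta); first by rewrite subr_gt0.
exists (C + A) => N N_gt0; apply: ge_ereal_sup => _ [alpha _ <-].
rewrite lee_fin /fourier_average /average Normc.normcM.
set z := expi alpha; have z1 : normc z = 1 := normc_expi alpha.
have NR_gt0 : 0 < N%:R :> R by rewrite ltr0n.
have -> : normc (N%:R^-1 : R[i]) = N%:R^-1.
  by rewrite Normc.normcV -(rmorph_nat (real_complex R)) normc_real ger0_norm.
have sum_le : normc (\sum_(n < N) (a n)%:C%C * expi (n%:R * alpha)) <=
    C * N%:R `^ theta + A.
  have -> : \sum_(n < N) (a n)%:C%C * expi (n%:R * alpha) =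
      expsum f z N i0 + (a 0%N)%:C%C.
    under eq_bigr => n _ do rewrite expi_nat mulrC -/z.
    case: N N_gt0 {NR_gt0} => // N _; rewrite /expsum !big_ord_recl.
    rewrite (proj1 (f_mem i0)) mulr0 add0r expr0 mul1r addrC; congr (_ + _).
    by apply: eq_bigr => n _; rewrite f_i0.
  apply: (le_trans (ler_normcD _ _)); apply: lerD; first exact: decay.
  by rewrite normc_real.
apply: (le_trans (ler_wpM2l _ sum_le)); first by rewrite invr_ge0.
have N_ge1 : 1 <= N%:R :> R by rewrite ler1n.
have -> : N%:R `^ (- (1 - theta)) = N%:R^-1 * N%:R `^ theta :> R.
  rewrite opprB powRD ?powRN ?powRr1 //; first exact: mulrC.
  by apply/implyP => _; rewrite gt_eqF.
rewrite mulrCA ler_wpM2l ?invr_ge0 // mulrDl lerD2l.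
rewrite ler_peMr ?(le_trans (normr_ge0 _) (a_le 0%N)) //.
by rewrite -[leLHS](powRr0 (N%:R : R)) ler_powR.
Qed.
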